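(* Let $\underline{A},\overline{A}\in\mathbb{R}^{n\times n}$ with $\underline{A}\le\overline{A}$ (entrywise), let $\mathbf{A}=\{A\in\mathbb{R}^{n\times n} : \underline{A}\le A\le\overline{A}\}$, and let $A^c=\frac12(\underline{A}+\overline{A})$. Assume that $A^c$ is an $M_0$-matrix. Then $\mathbf{A}$ is strongly semimonotone if and only if $\underline{A}$ is an $M_0$-matrix.
   Context: All inequalities between vectors or matrices are entrywise. A matrix property holds strongly for an interval matrix $\mathbf{A}$ if it holds for every $A\in\mathbf{A}$. For index sets $I,J\subseteq\{1,\dots,n\}$, $A_{I,J}$ is the submatrix of $A$ with rows indexed by $I$ and columns indexed by $J$. A matrix $A\in\mathbb{R}^{n\times n}$ is semimonotone (an $E_0$-matrix) if the linear complementarity problem $y=Az+q$, $y,z\ge0$, $y^Tz=0$ has a unique solution for each $q>0$; equivalently, if for each $\emptyset\ne I\subseteq\{1,\dots,n\}$ the system $A_{I,I}x<0$, $x\ge0$ is infeasible. A matrix $A\in\mathbb{R}^{n\times n}$ is an $M_0$-matrix if $A=sI_n-N$ for some $N\ge0$ and $s\in\mathbb{R}$ with $s\ge\rho(N)$, where $\rho$ is the spectral radius. *)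

(* Defs.v *)
From HB Require Import structures.
From mathcomp Require Import all_boot all_order all_algebra.
From mathcomp Require Import classical_sets reals.
From mathcomp Require Import complex.

Set Implicit Arguments.
Unset Strict Implicit.
Unset Printing Implicit Defensive.

Import Order.TTheory GRing.Theory Num.Theory.
Local Open Scope classical_set_scope.
Local Open Scope ring_scope.

Definition mxle (R : realType) (m n : nat) (A B : 'M[R]_(m, n)) : Prop :=
  forall i j, A i j <= B i j.

Definition mxlt (R : realType) (m n : nat) (A B : 'M[R]_(m, n)) : Prop :=
  forall i j, A i j < B i j.

Definition interval_mx (R : realType) (m n : nat) (Alo Aup : 'M[R]_(m, n)) :
  set 'M[R]_(m, n) := [set A | mxle Alo A /\ mxle A Aup].

Definition strongly (R : realType) (m n : nat) (P : 'M[R]_(m, n) -> Prop)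
  (AA : set 'M[R]_(m, n)) : Prop := forall A, AA A -> P A.

Definition midpoint_mx (R : realType) (m n : nat) (Alo Aup : 'M[R]_(m, n)) :
  'M[R]_(m, n) := 2^-1 *: (Alo + Aup).

Definition lcp_solution (R : realType) (n : nat) (A : 'M[R]_n) (q : 'cV[R]_n)
  (yz : 'cV[R]_n * 'cV[R]_n) : Prop :=
  [/\ yz.1 = A *m yz.2 + q, mxle 0 yz.1, mxle 0 yz.2 & yz.1^T *m yz.2 = 0].

Definition semimonotone (R : realType) (n : nat) (A : 'M[R]_n) : Prop :=
  forall q : 'cV[R]_n, mxlt 0 q -> exists! yz, lcp_solution A q yz.

(* The eigenvalues are taken in R[i].  They are finitely many, so the supremum
   is their maximal modulus; it is 0 when n = 0, where there is none. *)
Definition spectral_radius (R : realType) (n : nat) (A : 'M[R]_n) : R :=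
  sup [set Normc.normc l | l in
        [set l : R[i] | eigenvalue (map_mx (real_complex R) A) l]].

Definition M0_matrix (R : realType) (n : nat) (A : 'M[R]_n) : Prop :=
  exists (s : R) (N : 'M[R]_n),
    [/\ A = s%:M - N, mxle 0 N & spectral_radius N <= s].

(* Main.v *)
(* For a matrix [A = s - N] with [N >= 0], semimonotonicity and the M0 property
   both say that no [z >= 0], [z <> 0] satisfies [N z > s z] on its support:
   such a [z] is a second solution of some LCP with [q > 0]; entrywise moduli of
   an eigenvector of modulus greater than [s] give such a [z]; and, conversely,
   such a [z] satisfies [N z >= t z] for some [t > s], forcing the spectral
   radius above [s].  Semimonotonicity is inherited by entrywise larger
   matrices, which reduces the interval to its lower endpoint, and the
   off-diagonal entries of the lower endpoint are bounded by those of the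
   midpoint. *)
Require Import Defs.
From mathcomp Require Import all_boot all_order all_algebra.
From mathcomp Require Import classical_sets reals.
From mathcomp Require Import complex boolp topology normedtype derive.

Set Implicit Arguments.
Unset Strict Implicit.
Unset Printing Implicit Defensive.

Import Order.TTheory GRing.Theory Num.Theory.
Import numFieldNormedType.Exports.
Local Open Scope classical_set_scope.
Local Open Scope ring_scope.

(** * Eigenvalues and the spectral radius *)

Lemma eigenvalue_tr (F : fieldType) (n : nat) (A : 'M[F]_n) (a : F) :
  eigenvalue A^T a = eigenvalue A a.
Proof.
rewrite !eigenvalue_root_char /char_poly -[in RHS]det_tr.
by rewrite /char_poly_mx linearB /= tr_scalar_mx map_trmx.
Qed.

(** Scales [q] until it touches [z] from above; [c] is the largest ratio of coordinates. *)
Lemma exists_max_ratio (R : realType) (n : nat) (z q : 'I_n -> R) (i0 : 'I_n) :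
  (forall i, 0 < q i) -> 0 < z i0 ->
  exists c i, [/\ 0 < c, z i = c * q i & forall j, z j <= c * q j].
Proof.
move=> q0 zi0.
case: (@arg_maxP _ _ _ i0 xpredT (fun i => z i / q i)) => // i _ imax.
exists (z i / q i), i; split.
- by apply: lt_le_trans (imax i0 isT); rewrite divr_gt0.
- by rewrite divfK // gt_eqF.
- by move=> j; rewrite -ler_pdivrMr //; exact: imax.
Qed.

Lemma eigenvalue_modulus_subvector (R : realType) (n : nat) (N : 'M[R]_n)
  (l : R[i]) :
  mxle 0 N -> eigenvalue (map_mx (real_complex R) N) l ->
  exists z : 'cV[R]_n,
    [/\ mxle 0 z, z != 0 & mxle (Normc.normc l *: z) (N *m z)].
Proof.
(* [eigenvalue] concerns row vectors; transposing yields a column eigenvector, to which the triangle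
   inequality applies. *)
move=> N0; rewrite -eigenvalue_tr => /eigenvalueP[v vN v0].
exists (\col_i Normc.normc (v 0 i)); split.
- by move=> i j; rewrite !mxE -ler0c; exact: (normr_ge0 (v 0 i)).
- apply: contraNneq v0 => /colP z0; apply/eqP/rowP => i.
  by rewrite mxE; apply: Normc.eq0_normc; have := z0 i; rewrite !mxE.
- move=> i j; rewrite !mxE -Normc.normcM.
  have -> : l * v 0 i = \sum_k (N i k)%:C%C * v 0 k.
    have /rowP/(_ i) := vN; rewrite !mxE => <-.
    by apply: eq_bigr => k _; rewrite !mxE mulrC.
  rewrite -lecR -[leLHS]/`|_ : R[i]|; apply: le_trans (ler_norm_sum _ _ _) _.
  rewrite [leRHS]rmorph_sum /=; apply: ler_sum => k _; rewrite normrM.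
  rewrite ger0_norm ?ler0c; last by have := N0 i k; rewrite mxE.
  by rewrite mxE rmorphM.
Qed.

Lemma eigenvalue_le_spectral_radius (R : realType) (n : nat) (A : 'M[R]_n)
  (l : R[i]) :
  eigenvalue (map_mx (real_complex R) A) l ->
  Normc.normc l <= spectral_radius A.
Proof.
move=> lA; apply: ub_le_sup; last by exists l.
set p := char_poly (map_mx (real_complex R) A).
have [r pr] := closed_field_poly_normal p.
(* The supremum dominates only a bounded set: the sum of the moduli of all roots of the
   characteristic polynomial is a bound. *)
exists (\sum_(z <- r) Normc.normc z) => _ [z /= zA <-].
have zr : z \in r.
  move: zA; rewrite eigenvalue_root_char -/p pr.
  by rewrite (monicP (char_poly_monic _)) scale1r root_prod_XsubC.
rewrite (big_rem z zr) /= lerDl; apply: sumr_ge0 => x _.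
by rewrite -ler0c; exact: (normr_ge0 x).
Qed.

Lemma spectral_radius_le (R : realType) (n : nat) (A : 'M[R]_n) (s : R) :
  0 <= s ->
  (forall l, eigenvalue (map_mx (real_complex R) A) l -> Normc.normc l <= s) ->
  spectral_radius A <= s.
Proof.
move=> s0 As; rewrite /spectral_radius; set E := (X in sup X).
(* Without eigenvalues the supremum is 0 by convention, whence [0 <= s]. *)
have [->|/set0P E0] := eqVneq E set0; first by rewrite sup0.
by apply: ge_sup => // _ [l /= lA <-]; exact: As.
Qed.

Lemma real_eigenvalue_le_spectral_radius (R : realType) (n : nat)
  (A : 'M[R]_n) (m : R) :
  eigenvalue A m -> m <= spectral_radius A.
Proof.
move=> Am; apply: (@le_trans _ _ (Normc.normc m%:C%C)).
  by rewrite /= expr0n addr0 sqrtr_sqr ler_norm.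
apply: eigenvalue_le_spectral_radius; move: Am.
by rewrite !eigenvalue_root_char -map_char_poly /= fmorph_root.
Qed.

(** * Positive test vectors and lower bounds for the spectral radius *)

Lemma continuous_bigmin (R : realType) (T : topologicalType) (I : Type)
  (r : seq I) (c : R) (f : I -> T -> R) :
  (forall i, continuous (f i)) ->
  continuous (fun x => \big[Num.min/c]_(i <- r) f i x).
Proof.
move=> cf; elim: r => [|i r IH].
  under eq_fun do rewrite big_nil; exact: cst_continuous.
under eq_fun do rewrite big_cons.
by move=> x; apply: continuous_min; [exact: cf|exact: IH].
Qed.

(* The resolvent vector [(mu - N)^-1 1], scaled by the square of the
   determinant so that it is polynomial in [mu], is positive for large [mu].
   Its least coordinate cannot vanish first: at a zero coordinate,
   [mu w - N w] would be nonpositive. *)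
Lemma exists_positive_supervector (R : realType) (n : nat) (N : 'M[R]_n)
  (t : R) :
  mxle 0 N -> spectral_radius N < t ->
  exists w : 'cV[R]_n, mxlt 0 w /\ mxlt (N *m w) (t *: w).
Proof.
move=> N0 Nt.
have Nge0 i j : 0 <= N i j by have := N0 i j; rewrite mxE.
pose P := char_poly N *: (\adj (char_poly_mx N) *m (const_mx 1 : 'cV_n)).
pose W x : 'cV[R]_n := map_mx (horner_eval x) P.
have WE x : x *: W x - N *m W x = const_mx ((char_poly N).[x] ^+ 2).
  have : char_poly_mx N *m P = const_mx (char_poly N ^+ 2).
    rewrite -scalemxAr mulmxA mul_mx_adj mul_scalar_mx scalerA.
    by apply/matrixP => i j; rewrite !mxE mulr1 expr2.
  move/(congr1 (map_mx (horner_eval x))).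
  rewrite map_mxM map_const_mx /= [horner_eval x _]hornerE => <-.
  rewrite -mul_scalar_mx -mulmxBl; congr (_ *m _).
  by apply/matrixP => i j; rewrite !mxE /horner_eval !hornerE hornerMn hornerX.
have Dgt0 x : t <= x -> 0 < (char_poly N).[x] ^+ 2.
  move=> tx; rewrite exprn_even_gt0 //=; apply/negP => /eqP Dx.
  have : eigenvalue N x by rewrite eigenvalue_root_char; apply/rootP.
  move=> /real_eigenvalue_le_spectral_radius.
  by rewrite leNgt (lt_le_trans Nt).
have WEi x i : x * W x i 0 - \sum_j N i j * W x j 0 = (char_poly N).[x] ^+ 2.
  by have /colP/(_ i) := WE x; rewrite !mxE.
suff Wt i : 0 < W t i 0.
  exists (W t); split=> i j; rewrite ord1 [ltLHS]mxE //.
  by rewrite [ltRHS]mxE -subr_gt0 WEi; exact: Dgt0.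
(* The default 1 is positive, so a nonpositive minimum is attained at a coordinate. *)
pose f x := \big[Num.min/1]_i W x i 0.
have f_pos x : 0 < f x -> forall i, 0 < W x i 0.
  by move=> /lt_le_trans fx k; apply: fx; exact: bigmin_le.
apply: f_pos; move: i => _.
have fcont : continuous f.
  apply: continuous_bigmin => k.
  under eq_fun do rewrite mxE.
  exact: continuous_horner.
have f0 x : t <= x -> f x != 0.
  move=> tx; apply/negP => /eqP fx.
  have Wx j : 0 <= W x j 0 by rewrite -fx; exact: bigmin_le.
  have [k _ Wk] : exists2 k, true & W x k 0 <= 0.
    have : f x <= 0 by rewrite fx.
    by move=> /bigmin_leP[|//]; rewrite ler10.
  have := Dgt0 x tx; rewrite -(WEi x k) subr_gt0 ltNge.
  have -> : W x k 0 = 0 by apply/eqP; rewrite eq_le Wk Wx.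
  by rewrite mulr0 sumr_ge0 // => j _; rewrite mulr_ge0.
(* [K] is at least [t] and exceeds every row sum of [N]. If the least coordinate [k] of [W K] were
   nonpositive, then [K * W K k 0] would be at most the [k]-th coordinate of [N *m W K], against
   [WEi]. *)
pose K := `|t| + \sum_i \sum_j N i j + 1.
have S0 i : 0 <= \sum_j N i j by apply: sumr_ge0.
have tK : t <= K.
  rewrite /K -addrA; apply: le_trans (ler_norm t) _.
  by rewrite lerDl addr_ge0 // sumr_ge0.
have SK i : \sum_j N i j < K.
  rewrite /K [X in _ + X + _](bigD1 i) //= (addrC `|t|) -!addrA ltrDl.
  by apply: ltr_wpDl; rewrite ?sumr_ge0 // ltr_wpDl.
have fK : 0 < f K.
  rewrite lt0r f0 //= /f; apply/bigmin_geP; split=> // i0 _.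
  case: (@arg_minP _ _ _ i0 xpredT (fun i => W K i 0)) => // k _ kmin.
  apply: le_trans (kmin i0 isT); rewrite leNgt; apply/negP => Wk.
  have := Dgt0 K tK; rewrite -(WEi K k) subr_gt0 ltNge => /negP; apply.
  apply: (@le_trans _ _ (\sum_j N k j * W K k 0)).
    by rewrite -mulr_suml ler_wnM2r // ltW.
  by apply: ler_sum => j _; apply: ler_wpM2l => //; exact: kmin.
(* Otherwise [f] would vanish somewhere between [t] and [K]. *)
rewrite ltNge; apply/negP => ft.
have [||x + fx] := @IVT _ f t K 0 tK.
- by apply: continuous_subspaceT.
- by rewrite ge_min ft /= le_max (ltW fK) orbT.
by rewrite in_itv /= => /andP[tx _]; move: (f0 x tx); rewrite fx eqxx.
Qed.

(** Collatz-Wielandt argument: were the radius below [t], some [w > 0] would satisfy [N w < t w].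
    Scale [w] by [c] to touch [z] from above at [i]; there [t z <= N z <= c N w < c t w = t z]. *)
Lemma le_spectral_radius (R : realType) (n : nat) (N : 'M[R]_n) (z : 'cV[R]_n)
  (i0 : 'I_n) (t : R) :
  mxle 0 N -> 0 < z i0 0 -> mxle (t *: z) (N *m z) ->
  t <= spectral_radius N.
Proof.
move=> N0 zi0 zN; rewrite leNgt; apply/negP.
move=> /(exists_positive_supervector N0)[w [w0 wN]].
have wpos i : 0 < w i 0 by have := w0 i 0; rewrite mxE.
have [c [i [c0 zi zle]]] := @exists_max_ratio R n (z^~ 0) (w^~ 0) i0 wpos zi0.
have := zN i 0; rewrite leNgt => /negP; apply.
apply: (@le_lt_trans _ _ (c * (N *m w) i 0)).
  rewrite !mxE mulr_sumr; apply: ler_sum => j _.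
  rewrite mulrCA; apply: ler_wpM2l; last exact: zle.
  by have := N0 i j; rewrite mxE.
by rewrite [ltRHS]mxE zi mulrCA ltr_pM2l //; have := wN i 0; rewrite [ltRHS]mxE.
Qed.

(** * Semimonotone matrices and M0-matrices *)

Lemma semimonotoneP (R : realType) (n : nat) (A : 'M[R]_n) :
  semimonotone A <->
  forall z : 'cV[R]_n, mxle 0 z ->
    (forall i, 0 < z i 0 -> (A *m z) i 0 < 0) -> z = 0.
Proof.
split=> [Asm z z0 Az|AP q q0].
  have zge0 i : 0 <= z i 0 by have := z0 i 0; rewrite mxE.
  (* [y] is complementary to [z] and large enough off its support that [q = y - A z] is positive;
     then [(y, z)] and [(q, 0)] both solve the problem for [q]. *)
  pose y : 'cV[R]_n := \col_i
    (if 0 < z i 0 then 0 else `|(A *m z) i 0| + 1).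
  have q0 : mxlt 0 (y - A *m z).
    move=> i j; rewrite ord1 [ltLHS]mxE [ltRHS]mxE.
    rewrite [y i 0]mxE [(- (A *m z)) i 0]mxE.
    case: ifPn => [/Az Azi|_]; first by rewrite add0r oppr_gt0.
    by rewrite subr_gt0 ltr_pwDr // ler_norm.
  have [x [_ xuniq]] := Asm _ q0.
  have s1 : lcp_solution A (y - A *m z) (y, z).
    split=> //=; first by rewrite addrC subrK.
      by move=> i j; rewrite !mxE; case: ifP => // _; rewrite addr_ge0.
    apply/matrixP => i j; rewrite !ord1 !mxE big1 // => k _; rewrite !mxE.
    case: ifPn; first by rewrite mul0r.
    by rewrite lt0r zge0 andbT negbK => /eqP->; rewrite mulr0.
  have s2 : lcp_solution A (y - A *m z) (y - A *m z, 0).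
    split=> //=; rewrite ?mulmx0 ?add0r //.
    by move=> i j; apply: ltW; exact: q0.
  by have := xuniq _ s1; rewrite (xuniq _ s2) => -[_ ->].
exists (q, 0); split.
  split=> //=; rewrite ?mulmx0 ?add0r //.
  by move=> i j; apply: ltW; exact: q0.
move=> [y z] [/= yE y0 z0 yz].
suff zE : z = 0 by rewrite yE zE mulmx0 add0r.
apply: AP => // i zi.
have yge0 k : 0 <= y k 0 by have := y0 k 0; rewrite mxE.
have zge0 k : 0 <= z k 0 by have := z0 k 0; rewrite mxE.
(* Complementarity: the inner product is a vanishing sum of nonnegative terms. Hence [A z = - q < 0]
   on the support of [z]. *)
have yi : y i 0 = 0.
  have /matrixP/(_ 0 0)/eqP := yz; rewrite !mxE psumr_eq0; last first.
    by move=> k _; rewrite mxE mulr_ge0.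
  move=> /allP/(_ i); rewrite mem_index_enum => /(_ isT) /=.
  by rewrite mxE mulf_eq0 (gt_eqF zi) orbF => /eqP.
have /colP/(_ i) := yE; rewrite yi mxE => /esym/eqP.
rewrite addr_eq0 => /eqP->; rewrite oppr_lt0.
by have := q0 i 0; rewrite mxE.
Qed.

Lemma semimonotone_le (R : realType) (n : nat) (A B : 'M[R]_n) :
  mxle A B -> semimonotone A -> semimonotone B.
Proof.
move=> AB /semimonotoneP AP; apply/semimonotoneP => z z0 Bz.
apply: AP => // i /Bz; apply: le_lt_trans; rewrite !mxE.
apply: ler_sum => j _; apply: ler_wpM2r; last exact: AB.
by have := z0 j 0; rewrite mxE.
Qed.

Lemma M0_matrix_semimonotone (R : realType) (n : nat) (A : 'M[R]_n) :
  M0_matrix A -> semimonotone A.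
Proof.
move=> [s [N [-> N0 Ns]]]; apply/semimonotoneP => z z0 Az.
have zge0 k : 0 <= z k 0 by have := z0 k 0; rewrite mxE.
apply/eqP/negPn/negP => /cV0Pn[i0 zi0].
have {zi0}zi0 : 0 < z i0 0 by rewrite lt0r zi0 zge0.
(* The excess of [N z] over [s z] on the support of [z], with 1 as a positive filler elsewhere. From
   [z <= c q] the excess is at least [z / c], so [s] can be raised by [c^-1]. *)
pose q i := if 0 < z i 0 then (N *m z) i 0 - s * z i 0 else 1.
have AzE i : ((s%:M - N) *m z) i 0 = s * z i 0 - (N *m z) i 0.
  by rewrite mulmxBl mul_scalar_mx mxE [(s *: z) i 0]mxE [(- (N *m z)) i 0]mxE.
have q0 i : 0 < q i.
  rewrite /q; case: ifPn => [/Az|//]; rewrite AzE subr_lt0 subr_gt0 //.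
have [c [_ [c0 _ zle]]] :=
  @exists_max_ratio R n (z^~ 0) q i0 q0 zi0.
have : s + c^-1 <= spectral_radius N.
  apply: (@le_spectral_radius _ _ _ z i0) => // i j; rewrite ord1 mxE mulrDl.
  have [zi|] := boolP (0 < z i 0).
    rewrite addrC -lerBrDr mulrC ler_pdivrMr // mulrC.
    by have := zle i; rewrite /q zi.
  rewrite lt0r zge0 andbT negbK => /eqP->; rewrite !mulr0 addr0 mxE.
  by apply: sumr_ge0 => k _; rewrite mulr_ge0 //; have := N0 i k; rewrite mxE.
by move=> /le_trans/(_ Ns); rewrite gerDl leNgt invr_gt0 c0.
Qed.

Lemma semimonotone_M0_matrix (R : realType) (n : nat) (A : 'M[R]_n) :
  (forall i j, i != j -> A i j <= 0) -> semimonotone A -> M0_matrix A.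
Proof.
(* This [s] dominates every diagonal entry, making [s%:M - A] nonnegative. *)
move=> AZ /semimonotoneP AP; pose s := \sum_i `|A i i|.
have s0 : 0 <= s by apply: sumr_ge0.
have N0 : mxle 0 (s%:M - A).
  move=> i j; rewrite !mxE subr_ge0.
  have [<-|ij] := eqVneq i j; last by rewrite mulr0n AZ.
  rewrite mulr1n /s (bigD1 i) //=; apply: le_trans (ler_norm _) _.
  by rewrite lerDl sumr_ge0.
exists s, (s%:M - A); split=> //; first by rewrite subKr.
apply: spectral_radius_le => // l.
move=> /(eigenvalue_modulus_subvector N0)[z [z0 zn0 zN]].
(* If [l] had modulus above [s], then [A z <= (s - |l|) z < 0] on the support of [z]. *)
rewrite leNgt; apply: contra_neqN zn0 => sl; apply: AP => // i zi.
have := zN i 0; rewrite mulmxBl mul_scalar_mx.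
rewrite mxE [(s *: z - _) i 0]mxE [(s *: z) i 0]mxE [(- (A *m z)) i 0]mxE.
rewrite lerBrDr -lerBrDl => /le_lt_trans; apply.
by rewrite subr_lt0 ltr_pM2r.
Qed.

Theorem proposition6 (R : realType) (n : nat) (Alo Aup : 'M[R]_n)
  (hA : mxle Alo Aup) (hc : M0_matrix (midpoint_mx Alo Aup)) :
  strongly (@semimonotone R n) (interval_mx Alo Aup) <-> M0_matrix Alo.
Proof.
split=> [sm|/M0_matrix_semimonotone Alosm A [AloA _]]; last first.
  exact: semimonotone_le Alosm.
apply: semimonotone_M0_matrix; last by apply: sm; split.
have [s [N [Nc N0 _]]] := hc; move=> i j ij.
have /matrixP/(_ i j) := Nc; rewrite !mxE (negbTE ij) mulr0n add0r => mid.
have : 2^-1 * (Alo i j + Aup i j) <= 0.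
  by rewrite mid oppr_le0; have := N0 i j; rewrite mxE.
(* As [Alo <= Aup], twice the entry of [Alo] is at most the nonpositive sum. *)
rewrite pmulr_rle0 ?invr_gt0 // => /(le_trans _) Ale.
have := Ale (Alo i j + Alo i j); rewrite lerD2l hA => /(_ isT).
by rewrite -mulr2n pmulrn_lle0.
Qed.
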